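(* Let $n,r$ be integers with $r\ge 0$ and $n>r+1$, and let \[ S=\sum_{i=r+1}^{n-1}\binom{n}{i}. \] Then $H^{j}(VR(Q_n;r);\mathbb{Z})=0$ for all $j\ge 2^{n-1}-\frac{2^{n-2}S}{2S-1}-1$.
   Context: $Q_n$ denotes the set $\{0,1\}^n$ of vertices of the $n$-dimensional hypercube, equipped with the Hamming distance $d_H$ (the number of coordinates in which two binary strings differ). For $r\ge 0$, the Vietoris--Rips complex $VR(Q_n;r)$ is the simplicial complex with vertex set $Q_n$ whose simplices are the finite subsets of $Q_n$ of diameter at most $r$ with respect to $d_H$. Cohomology is simplicial (equivalently singular) cohomology of the geometric realisation. *)

(* Defs.v *)
From HB Require Import structures.
From mathcomp Require Import all_boot all_order all_algebra ring_quotient.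
From mathcomp Require Import boolp.

Set Implicit Arguments.
Unset Strict Implicit.
Unset Printing Implicit Defensive.

Import GRing.Theory Num.Theory.
Local Open Scope ring_scope.

(* The empty set is not counted as a simplex. *)
Record simplicial_complex (V : finType) := SimplicialComplex {
  simplices : {set {set V}};
  simplices_neq0 : forall s, s \in simplices -> s != set0;
  simplices_sub : forall s t : {set V},
    s \in simplices -> t \subset s -> t != set0 -> t \in simplices
}.

Section Cohomology.
Variables (V : finType) (K : simplicial_complex V).
Implicit Types (f g : {ffun {set V} -> int}) (k j : nat) (s : {set V}).

(* Cochains are graded by the number k of vertices, so degree j corresponds to
   k = j.+1. A cochain is an integer function on the k-vertex simplices,
   extended by 0 to all sets of vertices. As the empty set is not a simplex,
   the cochain group for k = 0 is trivial and the cohomology is unreduced. *)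
Definition nsimplices (k : nat) : {set {set V}} :=
  [set s in simplices K | #|s| == k].

Definition is_cochain (k : nat) (f : {ffun {set V} -> int}) : bool :=
  [forall s, (s \notin nsimplices k) ==> (f s == 0)].

(* The incidence sign uses the total order on V given by its enumeration:
   v is the i-th vertex of s, where i is the number of smaller vertices. *)
Definition vertex_index (s : {set V}) (v : V) : nat :=
  #|[set u in s | (enum_rank u < enum_rank v)%N]|.

Definition coboundary (k : nat) (f : {ffun {set V} -> int}) :
    {ffun {set V} -> int} :=
  [ffun s => if s \in nsimplices k.+1 then
               \sum_(v in s) (-1) ^+ vertex_index s v * f (s :\ v)
             else 0].

Lemma coboundaryB k : {morph coboundary k : f g / f - g}.
Proof.
move=> f g; apply/ffunP => s; rewrite !ffunE; case: ifP => _; last by rewrite subr0.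
by rewrite -sumrB; apply: eq_bigr => v _; rewrite !ffunE mulrBr.
Qed.

Lemma coboundary0 k : coboundary k 0 = 0.
Proof. by rewrite -[X in coboundary k X](subrr 0) coboundaryB subrr. Qed.

Lemma is_cochainP k f :
  reflect (forall s, s \notin nsimplices k -> f s = 0) (is_cochain k f).
Proof. by apply: (iffP 'forall_implyP) => h s /h /eqP. Qed.

Lemma is_cochain_zmod k : zmod_closed (is_cochain k).
Proof.
split=> [|f g /is_cochainP hf /is_cochainP hg]; apply/is_cochainP => s hs.
  by rewrite ffunE.
by rewrite !ffunE hf // hg // subr0.
Qed.

Lemma is_cochain_coboundary k f : is_cochain k.+1 (coboundary k f).
Proof. by apply/is_cochainP => s /negPf hs; rewrite ffunE hs. Qed.

Lemma nsimplicesD1 k s v : s \in nsimplices k.+2 -> v \in s ->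
  s :\ v \in nsimplices k.+1.
Proof.
rewrite !inE => /andP[sK /eqP cs] vs.
have cD : #|s :\ v| = k.+1 by move: (cardsD1 v s); rewrite vs cs => -[].
rewrite cD eqxx andbT; apply: (simplices_sub sK); first exact: subsetDl.
by rewrite -card_gt0 cD.
Qed.

Lemma vertex_indexD1 (s : {set V}) u v : v \in s ->
  vertex_index s u = ((enum_rank v < enum_rank u) + vertex_index (s :\ v) u)%N.
Proof.
move=> vs; rewrite /vertex_index.
rewrite (cardsD1 v) !inE vs /=; congr (_ + _)%N.
by apply: eq_card => w; rewrite !inE andbA.
Qed.

Lemma coboundaryK k f : coboundary k.+1 (coboundary k f) = 0.
Proof.
apply/ffunP => s; rewrite ffunE [RHS]ffunE; case: ifP => // sK.
pose F v w : int := (-1) ^+ vertex_index s v *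
  ((-1) ^+ vertex_index (s :\ v) w * f (s :\ v :\ w)).
have -> : \sum_(v in s) (-1) ^+ vertex_index s v * coboundary k f (s :\ v)
        = \sum_(v in s) \sum_(w in s | w != v) F v w.
  apply: eq_bigr => v vs; rewrite ffunE nsimplicesD1 // big_distrr /=.
  by apply: eq_bigl => w; rewrite !inE andbC.
have FN v w : v \in s -> w \in s -> w != v -> F v w = - F w v.
  move=> vs ws wv; rewrite /F setDDl setUC -setDDl !mulrA -mulNr; congr (_ * _).
  rewrite -!exprD (vertex_indexD1 v ws) (vertex_indexD1 w vs).
  have : enum_rank w != enum_rank v :> nat by rewrite (inj_eq val_inj) (inj_eq enum_rank_inj).
  by rewrite !exprD; case: ltngtP => //= _ _; rewrite expr0 expr1 !mul1r mulN1r
    ?mulNr ?opprK mulrC.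
set T := LHS.
have : T = - T.
  rewrite {1}/T (exchange_big_dep (mem s)) /=; last by move=> ? ? ? /andP[].
  rewrite /T -sumrN; apply: eq_bigr => w ws; rewrite -sumrN.
  apply: eq_big => [v|v]; first by rewrite ws eq_sym.
  by move=> /andP[vs /andP[_ wv]]; exact: FN.
by move/eqP; rewrite -addr_eq0 -mulr2n mulrn_eq0 /= => /eqP.
Qed.

Definition is_cocycle (j : nat) (f : {ffun {set V} -> int}) : bool :=
  is_cochain j.+1 f && (coboundary j.+1 f == 0).

Lemma is_cocycle_zmod j : zmod_closed (is_cocycle j).
Proof.
have [c0 cB] := is_cochain_zmod j.+1.
split=> [|f g /andP[hf /eqP df] /andP[hg /eqP dg]]; apply/andP; split.
- exact: c0.
- by rewrite coboundary0.
- exact: cB.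
- by rewrite coboundaryB df dg subr0.
Qed.

HB.instance Definition _ j :=
  GRing.isZmodClosed.Build {ffun {set V} -> int} (is_cocycle j)
    (is_cocycle_zmod j).

Record cocycle (j : nat) := Cocycle {
  cocycle_val :> {ffun {set V} -> int};
  cocycleP : is_cocycle j cocycle_val
}.

HB.instance Definition _ j := [isSub for @cocycle_val j].
HB.instance Definition _ j := [Choice of cocycle j by <:].
HB.instance Definition _ j := [SubChoice_isSubZmodule of cocycle j by <:].

Definition is_coboundary (j : nat) (f : cocycle j) : bool :=
  `[< exists g, is_cochain j g /\ val f = coboundary j g >].

Lemma is_coboundary_zmod j : zmod_closed (@is_coboundary j).
Proof.
split=> [|f g /asboolP[a [ha fa]] /asboolP[b [hb gb]]]; apply/asboolP.
  by exists 0; split; [case: (is_cochain_zmod j) | rewrite raddf0 coboundary0].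
exists (a - b); split; first by case: (is_cochain_zmod j) => _; apply.
by rewrite raddfB /= coboundaryB; congr (_ - _).
Qed.

HB.instance Definition _ j :=
  GRing.isZmodClosed.Build (cocycle j) (@is_coboundary j)
    (@is_coboundary_zmod j).

Definition coboundaries (j : nat) : zmodClosed (cocycle j) :=
  GRing.ZmodClosed.clone (cocycle j) (@is_coboundary j) _.

(* H^j(K; Z) *)
Definition cohomology (j : nat) : zmodType := Quotient.quot (coboundaries j).

End Cohomology.

Lemma cohomology_eq0P (V : finType) (K : simplicial_complex V) (j : nat) :
  (forall c : cohomology K j, c = 0) <->
  (forall f, is_cochain K j.+1 f -> coboundary K j.+1 f = 0 ->
     exists2 g, is_cochain K j g & f = coboundary K j g).
Proof.
split=> [h f cf df|h c].
  have zf : is_cocycle K j f by rewrite /is_cocycle cf df eqxx.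
  have := h (\pi_(Quotient.quot (coboundaries K j)) (Cocycle zf))%qT.
  move/eqP; rewrite -[X in _ == X](raddf0 (\pi_(Quotient.quot (coboundaries K j)))%qT).
  by rewrite -Quotient.idealrBE subr0 => /asboolP[g [? ?]]; exists g.
rewrite -[c]reprK; apply/eqP.
rewrite -[X in _ == X](raddf0 (\pi_(Quotient.quot (coboundaries K j)))%qT).
rewrite -Quotient.idealrBE subr0; apply/asboolP.
have /andP[cf /eqP df] := cocycleP (repr c).
by have [g ? ?] := h _ cf df; exists g.
Qed.

Section VietorisRips.
Variables (V : finType) (d : V -> V -> nat).

Definition diameter (s : {set V}) : nat :=
  (\max_(x in s) \max_(y in s) d x y)%N.

Definition vietoris_rips_simplices (r : nat) : {set {set V}} :=
  [set s | (s != set0) && (diameter s <= r)%N].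

Lemma vietoris_rips_neq0 r s :
  s \in vietoris_rips_simplices r -> s != set0.
Proof. by rewrite inE => /andP[]. Qed.

Lemma vietoris_rips_sub r (s t : {set V}) :
  s \in vietoris_rips_simplices r -> t \subset s -> t != set0 ->
  t \in vietoris_rips_simplices r.
Proof.
rewrite !inE => /andP[_ ds] /subsetP ts -> /=; apply: leq_trans ds.
apply/bigmax_leqP => x /ts xs; apply/bigmax_leqP => y /ts ys.
by apply: leq_trans (leq_bigmax_cond _ xs); apply: leq_bigmax_cond.
Qed.

Definition vietoris_rips (r : nat) : simplicial_complex V :=
  SimplicialComplex (@vietoris_rips_neq0 r) (@vietoris_rips_sub r).

End VietorisRips.

Definition hypercube (n : nat) : finType := {ffun 'I_n -> bool}.

Definition hamming (n : nat) (x y : hypercube n) : nat :=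
  #|[set i | x i != y i]|.

(* Main.v *)
Require Import Defs.
From mathcomp Require Import all_boot all_order all_algebra zify lra.

Set Implicit Arguments.
Unset Strict Implicit.
Unset Printing Implicit Defensive.

Import GRing.Theory Num.Theory.

(** A set of vertices of the cube is a simplex iff it contains no antipodal pair
    and no "far edge", i.e. no pair at distance between [r + 1] and [n - 1]. So
    the complex consists of the faces of the cross-polytope on the [2 ^ (n - 1)]
    antipodal pairs that avoid all far edges. Under Alexander duality in this
    sphere its cohomology becomes the homology of the independence complex of
    the graph of far edges, two of them conflicting when one contains the
    antipode of a vertex of the other. That graph has [2 ^ (n - 1) * S] vertices
    and maximal degree at most [2 * S - 1], and an independence complex with [N]
    vertices and maximal degree [D] has no homology below degree [N / 2D - 1].
    The inductive proof of this last fact is carried out directly on the dual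
    side: deleting a far edge [y] from the forbidden family [J] adds the faces
    containing [y], which gives a long exact sequence, and a family having a
    member without conflicts gives an acyclic complex. *)

(** * Cochains supported on a convex family of vertex sets *)

Section RelativeCochains.
Local Open Scope ring_scope.
Variable V : finType.
Implicit Types (P L U : {set {set V}}) (f g h : {ffun {set V} -> int}).
Implicit Types (s t : {set V}) (k : nat).

(** This is the augmented coboundary of the full simplex on [V]. The differential of a family [P] is
    [cobd] followed by [restrict P]. *)
Definition cobd f : {ffun {set V} -> int} :=
  [ffun s : {set V} => \sum_(v in s) (-1) ^+ vertex_index s v * f (s :\ v)].

Definition restrict P f : {ffun {set V} -> int} :=
  [ffun s : {set V} => if s \in P then f s else 0].

Definition supported P k f := forall s, f s != 0 -> s \in P /\ #|s| = k.

Definition convex_family P := forall s t u : {set V},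
  s \in P -> u \in P -> s \subset t -> t \subset u -> t \in P.

Definition upper_in P U := forall s t : {set V},
  s \in U -> t \in P -> s \subset t -> t \in U.

(* Cochains on a convex family compute the cohomology of a pair of complexes.
   They are graded by number of vertices and the empty set may belong to [P],
   so this is vanishing of reduced cohomology in degree [k - 1]. *)
Definition acyclic P k := forall f, supported P k f ->
  restrict P (cobd f) = 0 ->
  exists2 g : {ffun {set V} -> int}, (forall s, g s != 0 -> s \in P /\ #|s|.+1 = k) &
             restrict P (cobd g) = f.

Lemma cobdB : {morph cobd : f g / f - g}.
Proof.
move=> f g; apply/ffunP => s; rewrite !ffunE -sumrB.
by apply: eq_bigr => v _; rewrite !ffunE mulrBr.
Qed.

Lemma cobdD : {morph cobd : f g / f + g}.
Proof.
move=> f g; apply/ffunP => s; rewrite !ffunE -big_split.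
by apply: eq_bigr => v _; rewrite !ffunE mulrDr.
Qed.

Lemma restrictB P : {morph restrict P : f g / f - g}.
Proof. by move=> f g; apply/ffunP => s; rewrite !ffunE; case: ifP; rewrite ?subr0. Qed.

Lemma restrictD P : {morph restrict P : f g / f + g}.
Proof. by move=> f g; apply/ffunP => s; rewrite !ffunE; case: ifP; rewrite ?addr0. Qed.

Lemma cobd_neq0 f s : cobd f s != 0 -> exists2 v, v \in s & f (s :\ v) != 0.
Proof.
rewrite ffunE => nz; have [/existsP[v /andP[vs fv]]|] :=
  boolP [exists v, (v \in s) && (f (s :\ v) != 0)]; first by exists v.
rewrite negb_exists => /forallP fN; case/eqP: nz; apply: big1 => v vs.
by have := fN v; rewrite vs negbK => /eqP ->; rewrite mulr0.
Qed.

Lemma restrict_neq0 P f s : restrict P f s != 0 -> s \in P /\ f s != 0.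
Proof. by rewrite ffunE; case: ifP => // _; rewrite eqxx. Qed.

Lemma supported_cobd P k f : (forall s, f s != 0 -> s \in P /\ #|s|.+1 = k) ->
  supported P k (restrict P (cobd f)).
Proof.
move=> sf s /restrict_neq0[sP /cobd_neq0[v vs /sf[_ <-]]]; split=> //.
by rewrite (cardsD1 v) vs.
Qed.

Lemma full_simplex_neq0 s : s \in [set s : {set V} | s != set0] -> s != set0.
Proof. by rewrite inE. Qed.

Lemma full_simplex_sub s t : s \in [set s : {set V} | s != set0] ->
  t \subset s -> t != set0 -> t \in [set s : {set V} | s != set0].
Proof. by rewrite !inE. Qed.

Definition full_simplex :=
  SimplicialComplex full_simplex_neq0 full_simplex_sub.

(** On nonempty sets [cobd] is the coboundary of the full simplex, so [coboundaryK] applies. Sets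
    with at most one vertex, where the empty set enters, are checked directly. *)
Lemma cobdK f : cobd (cobd f) = 0.
Proof.
have cE k g s : #|s| = k.+1 -> coboundary full_simplex k g s = cobd g s.
  by move=> cs; rewrite !ffunE !inE -card_gt0 cs eqxx.
apply/ffunP => s; rewrite [RHS]ffunE.
have cD v : v \in s -> #|s :\ v|.+1 = #|s| by move=> vs; rewrite [RHS](cardsD1 v) vs.
case cs: #|s| => [|[|k]].
- by rewrite (cards0_eq cs) ffunE big_set0.
- rewrite ffunE big1 // => v /cD; rewrite cs => -[/cards0_eq ->].
  by rewrite ffunE big_set0 mulr0.
rewrite -(cE k.+1) //.
transitivity (coboundary full_simplex k.+1 (coboundary full_simplex k f) s);
  last by rewrite coboundaryK ffunE.
rewrite ffunE [RHS]ffunE; case: ifP => // _; apply: eq_bigr => v /cD.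
by rewrite cs => -[?]; rewrite cE.
Qed.

(** The inner restriction loses nothing: a value of [cobd f] at a face of [s] comes from some
    smaller member of [P], and convexity then puts that face in [P]. *)
Lemma restrict_cobdK P k f : convex_family P -> supported P k f ->
  restrict P (cobd (restrict P (cobd f))) = 0.
Proof.
move=> cP sf; rewrite -[RHS](_ : restrict P 0 = 0); last first.
  by apply/ffunP => s; rewrite !ffunE if_same.
rewrite -(cobdK f); apply/ffunP => s; rewrite [LHS]ffunE [RHS]ffunE.
case: ifP => // sP; rewrite ffunE [RHS]ffunE; apply: eq_bigr => v vs.
congr (_ * _); rewrite ffunE; case: ifPn => // sPv; apply/esym/eqP.
apply: contraR sPv => /cobd_neq0[w _ /sf[wP _]].
by apply: cP wP sP _ _; rewrite subsetDl.
Qed.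

(** * The long exact sequence of a lower and an upper part *)

Section ExactSequence.
Variables (P L U : {set {set V}}).
Hypotheses (cP : convex_family P) (PLU : P = L :|: U) (LU : [disjoint L & U]).
Hypothesis (uU : upper_in P U).

Lemma lower_sub s : s \in L -> s \in P. Proof. by rewrite PLU inE => ->. Qed.
Lemma upper_sub s : s \in U -> s \in P. Proof. by rewrite PLU inE orbC => ->. Qed.
Lemma lowerE s : s \in L = (s \in P) && (s \notin U).
Proof.
rewrite PLU inE; have /= := disjointFr LU (x := s).
by case: (s \in L) => [-> //|_]; case: (s \in U).
Qed.

(** Coboundaries only enlarge sets, so cochains on [U] form a subcomplex of those on [P]. *)
Lemma restrict_upper f : (forall s, f s != 0 -> s \in U) ->
  restrict P (cobd f) = restrict U (cobd f).
Proof.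
move=> sf; apply/ffunP => s; rewrite ffunE [RHS]ffunE.
case: (boolP (s \in U)) => [/upper_sub -> //|sU]; case: ifP => // sP.
apply/eqP; apply: contraR sU => /cobd_neq0[v vs /sf /uU]; apply=> //.
exact: subsetDl.
Qed.

(** Cochains on [L] form the matching quotient: restriction to [L] commutes with the
    differentials. *)
Lemma restrict_lower f : (forall s, f s != 0 -> s \in P) ->
  restrict L (cobd (restrict L f)) = restrict L (cobd f).
Proof.
move=> sf; apply/ffunP => s; rewrite ffunE [RHS]ffunE.
case: ifP => // sL; rewrite ffunE [RHS]ffunE; apply: eq_bigr => v vs.
congr (_ * _); rewrite ffunE; case: ifPn => // nL; apply/esym/eqP.
apply: contraNT nL => /sf svP; rewrite lowerE svP /=.
move: sL; rewrite lowerE => /andP[sP]; apply: contraNN => /uU; apply=> //.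
exact: subsetDl.
Qed.

Lemma restrict_restrict_lower f : restrict L (restrict P f) = restrict L f.
Proof.
by apply/ffunP => s; rewrite ffunE [RHS]ffunE; case: ifP => // /lower_sub sP;
  rewrite ffunE sP.
Qed.

Lemma restrict_lower0 f : restrict L f = 0 ->
  (forall s, f s != 0 -> s \in P) -> forall s, f s != 0 -> s \in U.
Proof.
move=> f0 sf s fs; have := sf s fs; rewrite PLU inE => /orP[sL|//].
by move/ffunP/(_ s): f0 fs; rewrite ffunE sL => ->; rewrite ffunE eqxx.
Qed.

(** Exactness at [L]. In [P] the coboundary of a cocycle [f] on [L] lives on [U], where it bounds
    some [h]. Then [f - h] is a cocycle on [P], and a primitive of it restricts to one of [f]. *)
Lemma acyclic_lower k : acyclic P k -> acyclic U k.+1 -> acyclic L k.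
Proof.
move=> aP aU f sf f0.
have sfP : supported P k f by move=> s /sf[/lower_sub].
have sd : supported P k.+1 (restrict P (cobd f)).
  by apply: supported_cobd => s /sfP[? ->].
have sdU : supported U k.+1 (restrict P (cobd f)).
  move=> s fs; split; last by case: (sd s fs).
  apply: restrict_lower0 fs; last by move=> t /sd[].
  by rewrite restrict_restrict_lower.
have [|h sh dh] := aU _ sdU.
  by rewrite -restrict_upper ?(restrict_cobdK cP sfP) // => s /sdU[].
have dhP : restrict P (cobd h) = restrict P (cobd f).
  by rewrite restrict_upper ?dh // => s /sh[].
have sfh : supported P k (f - h).
  move=> s; rewrite !ffunE; case: (eqVneq (f s) 0) => [->|/sfP //].
  by rewrite sub0r oppr_eq0 => /sh[/upper_sub ? [?]].
have [|g sg dg] := aP _ sfh; first by rewrite cobdB restrictB dhP subrr.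
exists (restrict L g).
  by move=> s /restrict_neq0[sL /sg[]].
rewrite restrict_lower; last by move=> s /sg[].
rewrite -restrict_restrict_lower dg; apply/ffunP => s; rewrite !ffunE.
case: ifP => [sL|/negP sL].
  have [-> |/sh[]] := eqVneq (h s) 0; first by rewrite subr0.
  by move: sL; rewrite lowerE => /andP[_ /negP].
by have [->//|/sf[]] := eqVneq (f s) 0.
Qed.

(** Exactness at [P]: subtracting the coboundary of a primitive on [L] leaves a cocycle on [U]. *)
Lemma acyclic_union k : acyclic U k -> acyclic L k -> acyclic P k.
Proof.
move=> aU aL f sf f0.
have sfL : supported L k (restrict L f) by move=> s /restrict_neq0[? /sf[]].
have [|g sg dg] := aL _ sfL.
  rewrite restrict_lower; last by move=> s /sf[].
  rewrite -restrict_restrict_lower f0; apply/ffunP => s.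
  by rewrite !ffunE if_same.
have sgP s : g s != 0 -> s \in P /\ #|s|.+1 = k by move=> /sg[/lower_sub].
have sdg := supported_cobd sgP.
set h := f - restrict P (cobd g).
have shP : supported P k h.
  move=> s; rewrite !ffunE; have [->|/sf //] := eqVneq (f s) 0.
  move=> nz; apply: sdg; rewrite ffunE; move: nz; rewrite ffunE.
  by rewrite sub0r oppr_eq0.
have shU : supported U k h.
  move=> s hs; split; last by case: (shP s hs).
  apply: restrict_lower0 hs; last by move=> t /shP[].
  by rewrite restrictB restrict_restrict_lower dg subrr.
have dh : restrict P (cobd h) = 0.
  rewrite cobdB restrictB f0 (restrict_cobdK (k := k.-1) cP) ?subr0 //.
  by move=> s /sgP[? <-].
have [|g' sg' dg'] := aU _ shU.
  by rewrite -restrict_upper // => s /shU[].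
exists (g + g').
  move=> s; rewrite ffunE; have [->|/sgP //] := eqVneq (g s) 0.
  by rewrite add0r => /sg'[/upper_sub].
rewrite cobdD restrictD [X in _ + X]restrict_upper ?dg' => [|s /sg'[] //].
by rewrite addrC subrK.
Qed.

End ExactSequence.

(** * Acyclicity for dimension reasons and for cones *)

Lemma acyclic_dim P k : (forall s, s \in P -> #|s| != k) -> acyclic P k.
Proof.
move=> Pk f sf _; have -> : f = 0.
  apply/ffunP => s; rewrite [RHS]ffunE; apply/eqP; apply: contraT => /sf[/Pk].
  by move=> + sk; rewrite sk eqxx.
exists 0; first by move=> s; rewrite ffunE eqxx.
by rewrite -[X in cobd X](subrr 0) cobdB restrictB subrr.
Qed.

(** The usual contraction [g] towards the apex [w] makes [h], the difference of [f] and the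
    coboundary of [g], vanish on sets containing [w]. For other [s] the cocycle condition at
    [w |: s] has [h s] as its only remaining term. *)
Lemma acyclic_cone P w k : convex_family P ->
  (forall s, w \notin s -> (w |: s \in P) = (s \in P)) -> acyclic P k.
Proof.
move=> cP wP f sf f0.
pose g : {ffun {set V} -> int} := [ffun s : {set V} => if w \in s then 0 else
  (-1) ^+ vertex_index (w |: s) w * f (w |: s)].
have sg s : g s != 0 -> s \in P /\ #|s|.+1 = k.
  rewrite ffunE; case: ifPn => [_|ws]; first by rewrite eqxx.
  rewrite mulf_eq0 negb_or => /andP[_ /sf[]].
  by rewrite wP // cardsU1 ws.
exists g => //; apply/eqP; rewrite -subr_eq0; apply/eqP.
have sdg := supported_cobd sg.
set h := _ - _.
have sh : supported P k h.
  move=> s; rewrite !ffunE; have [->|/sf //] := eqVneq (f s) 0.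
  move=> nz; apply: sdg; rewrite ffunE; move: nz; rewrite ffunE.
  by rewrite subr0.
have hw s : w \in s -> h s = 0.
  move=> ws; apply/eqP; apply: contraT => nz; have [sP _] := sh _ nz.
  rewrite -(negbTE nz) !ffunE sP (bigD1 w) //= big1 ?addr0 => [|v /andP[vs vw]].
    by rewrite ffunE !inE eqxx /= setD1K // mulrA -expr2 sqrr_sign mul1r subrr.
  by rewrite ffunE !inE eq_sym vw ws mulr0.
have dh : restrict P (cobd h) = 0.
  rewrite cobdB restrictB f0 (restrict_cobdK (k := k.-1) cP) ?subr0 //.
  by move=> s /sg[? <-].
apply/ffunP => s; rewrite [RHS]ffunE; have [/hw //|ws] := boolP (w \in s).
have [//|nz] := eqVneq (h s) 0; have [sP _] := sh _ nz.
move/ffunP/(_ (w |: s)): dh; rewrite !ffunE wP // sP.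
rewrite (bigD1 w) ?setU11 //= big1 ?addr0 => [|v /andP[_ vw]]; last first.
  by rewrite hw ?mulr0 // !inE eq_sym vw eqxx.
rewrite setU1K // => /eqP; rewrite mulf_eq0 signr_eq0 /= => /eqP h0.
by rewrite h0 eqxx in nz.
Qed.

End RelativeCochains.

(** * Faces of a cross-polytope avoiding forbidden sets *)

Section AntipodalFaces.
Variables (V : finType) (a : V -> V).
Hypothesis aK : involutive a.
Implicit Types (s t e f g x y : {set V}) (J : {set {set V}}).

(** For faces [s] and [t] this says that their union is again a face. The faces themselves are the
    sets with [compat s s]. *)
Definition compat s t := [forall v in s, a v \notin t].

Lemma compatP s t : reflect (forall v, v \in s -> a v \notin t) (compat s t).
Proof. exact: forall_inP. Qed.

Lemma compat_sym s t : compat s t = compat t s.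
Proof.
wlog suff: s t / compat s t -> compat t s by move=> h; apply/idP/idP; apply: h.
by move/compatP=> h; apply/compatP => v vt; apply/negP => /h; rewrite aK vt.
Qed.

Lemma compatS s s' t t' : s' \subset s -> t' \subset t ->
  compat s t -> compat s' t'.
Proof.
move=> /subsetP ss /subsetP tt /compatP h; apply/compatP => v /ss/h.
exact/contraNN/tt.
Qed.

Lemma compatUl s s' t : compat (s :|: s') t = compat s t && compat s' t.
Proof.
apply/compatP/andP => [h|[/compatP h /compatP h'] v].
  by split; apply/compatP => v vs; apply: h; rewrite inE vs ?orbT.
by rewrite inE => /orP[/h|/h'].
Qed.

(* Faces of the cross-polytope with antipodal pairs [{v, a v}] that contain
   [e] and contain no member of [J]. *)
Definition faces e J : {set {set V}} :=
  [set s | [&& compat s s, e \subset s & [forall f in J, ~~ (f \subset s)]]].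

Lemma facesP e J s :
  reflect [/\ compat s s, e \subset s & forall f, f \in J -> ~~ (f \subset s)]
          (s \in faces e J).
Proof. by rewrite inE; apply: (iffP and3P) => -[? ? /forall_inP]. Qed.

Lemma faces_convex e J : convex_family (faces e J).
Proof.
move=> s t u /facesP[_ es _] /facesP[uu _ uJ] st tu; apply/facesP; split.
- exact: compatS uu.
- exact: subset_trans st.
- by move=> f /uJ; apply: contraNN => /subset_trans; apply.
Qed.

Lemma faces_split e J y : y \in J ->
  faces e (J :\ y) = faces e J :|: faces (e :|: y) (J :\ y).
Proof.
move=> yJ; apply/setP => s; rewrite in_setU; apply/facesP/orP.
  move=> [ss es sJ]; have [ys|ys] := boolP (y \subset s); [right|left].
    by apply/facesP; split=> //; rewrite subUset es.
  apply/facesP; split=> // f fJ; have [->//|fy] := eqVneq f y.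
  by apply: sJ; rewrite !inE fy.
case=> /facesP[ss es sJ]; split=> //.
  by move=> f; rewrite !inE => /andP[_ /sJ].
by move: es; rewrite subUset => /andP[].
Qed.

Lemma faces_split_disjoint e J y : y \in J ->
  [disjoint faces e J & faces (e :|: y) (J :\ y)].
Proof.
move=> yJ; rewrite disjoint_subset; apply/subsetP => s /facesP[_ _ /(_ y yJ)].
by apply: contraNN => /facesP[_]; rewrite subUset => /andP[].
Qed.

Lemma faces_upper e e' J : upper_in (faces e J) (faces (e :|: e') J).
Proof.
move=> s t /facesP[_ es _] /facesP[tt _ tJ] st; apply/facesP; split=> //.
exact: subset_trans st.
Qed.

(** A face containing [y] cannot contain anything in conflict with [y], so these members forbid
    nothing. *)
Lemma faces_compat e J y : y \subset e ->
  faces e J = faces e [set f in J | compat y f].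
Proof.
move=> ye; apply/setP => s; apply/facesP/facesP => -[ss es sJ]; split=> //.
  by move=> f; rewrite inE => /andP[/sJ].
move=> f fJ; have [yf|] := boolP (compat y f); first by apply: sJ; rewrite inE fJ.
apply: contraNN => fs; apply: compatS ss => //.
exact: subset_trans es.
Qed.

(** Induction on the vertices of [f] missing from [e]. If none is missing, there are no faces.
    Otherwise split at a missing vertex [v]: faces with [v] fall to induction, and faces without it
    form a cone. *)
Lemma acyclic_faces_isolated f e J k : f \in J -> compat f e ->
  {in J, forall g, compat f g} -> acyclic (faces e J) k.
Proof.
move=> fJ; have [N] := ubnP #|f :\: e|; elim: N e => // N IH e.
rewrite ltnS => cN fe fcJ.
have [fe0|[v]] := set_0Vmem (f :\: e).
  apply: acyclic_dim => s /facesP[_ es /(_ f fJ)/negP[]].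
  by apply: subset_trans es; rewrite -setD_eq0 fe0.
rewrite in_setD => /andP[ve vf].
have /compatP/(_ v vf) ave := fe.
have avJ g : g \in J -> a v \notin g by move=> /fcJ /compatP; apply.
have vav : a v != v by apply: contraTneq (avJ _ fJ) => ->; rewrite vf.
set L := [set s in faces e J | v \notin s].
apply: (@acyclic_union _ _ L (faces (e :|: [set v]) J)).
- exact: faces_convex.
- apply/setP => s; rewrite in_setU [s \in L]in_set.
  apply/idP/orP => [sP|[/andP[] //|/facesP[ss + sJ]]].
    have [vs|vs] := boolP (v \in s); [right|by left; rewrite sP].
    have /facesP[ss es sJ] := sP.
    by apply/facesP; split=> //; rewrite subUset es sub1set.
  by rewrite subUset => /andP[es _]; apply/facesP.
- rewrite disjoint_subset; apply/subsetP => s; rewrite in_set => /andP[_].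
  by apply: contraNN => /facesP[_]; rewrite subUset sub1set => /andP[].
- exact: faces_upper.
- apply: IH => //; last first.
    rewrite compat_sym compatUl compat_sym fe /=; apply/compatP => w.
    by rewrite inE => /eqP->; exact: avJ.
  apply: leq_trans cN; apply: proper_card; apply/properP; split.
    by apply: setDS; exact: subsetUl.
  by exists v; rewrite !inE ?ve ?vf ?eqxx ?orbT.
(* The apex is [a v]: once [v] is absent it can be added freely, as no member of [J] contains it,
   and it can be removed because it is not in [e]. *)
apply: (@acyclic_cone _ _ (a v)) => [s t u|s avs].
  rewrite [s \in L]in_set [t \in L]in_set [u \in L]in_set.
  move=> /andP[sP _] /andP[uP vu] st tu; rewrite (faces_convex sP uP) //=.
  by apply: contraNN vu; exact: (subsetP tu).
rewrite [LHS]in_set [RHS]in_set in_setU1 eq_sym (negbTE vav) /=.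
have [vs|vs] := boolP (v \in s); rewrite ?andbF ?andbT //.
apply/facesP/facesP => -[ss es sJ]; split.
- by apply: compatS ss; rewrite subsetUr.
- apply/subsetP => w we; have := subsetP es w we.
  by rewrite in_setU1 => /orP[/eqP wE|//]; rewrite -wE we in ave.
- by move=> g /sJ; apply: contraNN => /subset_trans; apply; exact: subsetUr.
- apply/compatP => w; rewrite !in_setU1 => /orP[/eqP->|ws].
    by rewrite aK (negbTE vs) eq_sym (negbTE vav).
  rewrite (inj_eq (inv_inj aK)) (negbTE (compatP _ _ ss w ws)) orbF.
  by apply: contraNneq vs => <-.
- by apply: subset_trans es _; exact: subsetUr.
- move=> g gJ; apply: contraNN (sJ g gJ) => /subsetP gs; apply/subsetP => w wg.
  have := gs w wg; rewrite in_setU1 => /orP[/eqP wE|//].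
  by have := avJ g gJ; rewrite -wE wg.
Qed.

Variables (m D : nat).
Hypothesis card_face : forall s, compat s s -> #|s| <= m.

Definition conflicts J f := [set g in J | ~~ compat f g].

(* The slack [D - #|conflicts J x|] pays for deleting the conflicts of [x] one
   by one: once they are gone, [x] is isolated. *)
Lemma acyclic_faces_slack J x e k : x \in J ->
  {in J, forall f, compat f f} -> {in J, forall f, compat e f} ->
  {in J, forall f, #|conflicts J f| <= D} ->
  2 * D * m < #|J| + (D - #|conflicts J x|) + 2 * D * k ->
  acyclic (faces e J) k.
Proof.
have [N] := ubnP #|J|; elim: N J x e k => // N IH J x e k.
rewrite ltnS => cN xJ JJ eJ cJ bound.
have [x0|[y]] := set_0Vmem (conflicts J x).
  apply: (acyclic_faces_isolated xJ); first by rewrite compat_sym eJ.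
  move=> g gJ; apply: contraT => xg; have : g \in conflicts J x by rewrite inE gJ.
  by rewrite x0 inE.
rewrite inE => /andP[yJ xy].
have cJy : #|J :\ y|.+1 = #|J| by rewrite [RHS](cardsD1 y) yJ.
have yx : x != y by apply: contraNneq xy => <-; exact: JJ.
have cx : #|conflicts (J :\ y) x|.+1 = #|conflicts J x|.
  rewrite [RHS](cardsD1 y) inE yJ xy; congr _.+1; apply: eq_card => g.
  by rewrite !inE andbA.
have subc J' f : J' \subset J -> #|conflicts J' f| <= #|conflicts J f|.
  move=> /subsetP JJ'; apply/subset_leq_card/subsetP => g.
  by rewrite !inE => /andP[/JJ' -> ->].
have cDx := cJ _ xJ.
apply: (acyclic_lower (@faces_convex e (J :\ y)) (faces_split e yJ)
  (faces_split_disjoint e yJ)); first exact: faces_upper.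
  have JyJ : {subset J :\ y <= J} by move=> f; rewrite !inE => /andP[].
  (* The family loses one member and the slack of [x] grows by one, so the bound is unchanged. *)
  apply: (IH _ x) => //.
  - by rewrite cJy.
  - by rewrite !inE yx.
  - by move=> f /JyJ /JJ.
  - by move=> f /JyJ /eJ.
  - by move=> f /JyJ /cJ; apply: leq_trans; apply: subc; exact: subsetDl.
  - by lia.
rewrite (faces_compat _ (subsetUr e y)).
set J' := [set f in _ | _].
have J'J : {subset J' <= J} by move=> f; rewrite !inE => /andP[/andP[_ ->]].
have J'Js : J' \subset J by apply/subsetP.
have cJ' : #|J| <= #|J'| + D + 1.
  have -> : J = (J' :|: conflicts J y) :|: [set y].
    apply/setP => f; rewrite !inE; have [->|] := eqVneq f y; first by rewrite yJ orbT.
    by rewrite orbF /=; case: (f \in J); case: (compat y f).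
  rewrite (leq_trans (leq_card_setU _ _)) // cards1 leq_add2r.
  rewrite (leq_trans (leq_card_setU _ _)) // leq_add2l.
  exact: cJ.
have J'N : #|J'| < N.
  apply: leq_trans cN; rewrite -cJy ltnS; apply/subset_leq_card/subsetP => f.
  by rewrite inE => /andP[].
(* Passing to [J'] loses at most [D + 1] members, while the degree shift gains [2 * D]. The net gain
   [D - 1] covers the old slack because [x] has at least the conflict [y]. *)
have bound' : 2 * D * m < #|J'| + 2 * D * k.+1 by rewrite mulnS; lia.
(* With [J'] empty the bound reads [m < k.+1], and no face is that large. *)
have [J0|[z zJ']] := set_0Vmem J'.
  apply: acyclic_dim => s /facesP[/card_face sm _ _]; move: bound'.
  rewrite J0 cards0 add0n ltn_mul2l => /andP[_].
  by apply: contraTneq => <-; rewrite -leqNgt.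
apply: (IH _ z) => //.
- by move=> f /J'J /JJ.
- move=> f fJ'; rewrite compatUl eJ ?J'J //=.
  by move: fJ'; rewrite inE => /andP[].
- by move=> f /J'J /cJ; apply: leq_trans; apply: subc.
- by apply: leq_trans bound' _; rewrite leq_add2r leq_addr.
Qed.

Lemma acyclic_faces J k : J != set0 ->
  {in J, forall f, compat f f} -> {in J, forall f, #|conflicts J f| <= D} ->
  2 * D * m < #|J| + 2 * D * k -> acyclic (faces set0 J) k.
Proof.
case/set0Pn => x xJ JJ cJ bound; apply: (acyclic_faces_slack xJ) => //.
  by move=> f _; apply/compatP => v; rewrite inE.
by apply: leq_trans bound _; rewrite leq_add2r leq_addr.
Qed.

End AntipodalFaces.

(** * From acyclic families to the cohomology of a complex *)

Lemma restrict_cobdE (V : finType) (K : simplicial_complex V)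
    (P : {set {set V}}) (k : nat) (f : {ffun {set V} -> int}) :
  (forall s, s != set0 -> (s \in P) = (s \in simplices K)) ->
  (forall s, f s != 0%R -> #|s| = k) ->
  restrict P (cobd f) = coboundary K k f.
Proof.
move=> PK fk; apply/ffunP => s; rewrite ffunE [RHS]ffunE inE.
have [sk|sk] := eqVneq #|s| k.+1.
  by rewrite andbT PK ?ffunE // -card_gt0 sk.
rewrite andbF; case: ifP => // _; apply/eqP; apply: contraR sk.
by case/cobd_neq0 => v vs /fk <-; rewrite (cardsD1 v) vs.
Qed.

(** The family may contain the empty set and the complex does not; this affects only degree 0, where
    reduced and unreduced cohomology differ. *)
Lemma acyclic_cohomology (V : finType) (K : simplicial_complex V)
    (P : {set {set V}}) (j : nat) :
  (forall s, s != set0 -> (s \in P) = (s \in simplices K)) ->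
  0 < j -> acyclic P j.+1 -> forall c : cohomology K j, c = 0%R.
Proof.
move=> PK j0 aP; apply/cohomology_eq0P => f /is_cochainP cf df.
have sf : supported P j.+1 f.
  move=> s fs; have: s \in nsimplices K j.+1.
    by apply: contraT => /cf f0; rewrite f0 eqxx in fs.
  by rewrite inE => /andP[sK /eqP sj]; rewrite PK // -card_gt0 sj.
have [|g sg <-] := aP f sf.
  by rewrite (restrict_cobdE (k := j.+1) PK) // => s /sf[].
have gj s : g s != 0%R -> #|s| = j by move=> /sg[_ []].
exists g; last exact: restrict_cobdE.
apply/is_cochainP => s; rewrite inE; apply: contraNeq => gs.
have [sP _] := sg s gs; have sj := gj s gs.
by rewrite sj eqxx andbT -PK // -card_gt0 sj.
Qed.

(** * Counting far edges of the cube and their conflicts *)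

Section Hypercube.
Variable n : nat.
Implicit Types (x y z : hypercube n).

Definition antipode x : hypercube n := [ffun i => ~~ x i].

Lemma antipodeK : involutive antipode.
Proof. by move=> x; apply/ffunP => i; rewrite !ffunE negbK. Qed.

Lemma hamming_sym x y : hamming x y = hamming y x.
Proof. by apply: eq_card => i; rewrite !inE eq_sym. Qed.

Lemma hammingxx x : hamming x x = 0.
Proof. by apply: eq_card0 => i; rewrite !inE eqxx. Qed.

Lemma hamming_antipode x y : hamming (antipode x) (antipode y) = hamming x y.
Proof. by apply: eq_card => i; rewrite !inE !ffunE (inj_eq negb_inj). Qed.

Lemma hamming_le x y : hamming x y <= n.
Proof. by rewrite -[leqRHS]card_ord max_card. Qed.

Lemma hamming_eqn x y : (hamming x y == n) = (y == antipode x).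
Proof.
apply/eqP/eqP => [|->]; last first.
  by rewrite -[RHS]card_ord; apply: eq_card => i; rewrite !inE ffunE; case: (x i).
move=> xyn; apply/ffunP => i; rewrite ffunE.
have : i \in [set i | x i != y i].
  suff -> : [set i | x i != y i] = setT by rewrite inE.
  by apply/eqP; rewrite eqEcard subsetT cardsT card_ord /= -[leqLHS]xyn.
by rewrite inE; case: (x i); case: (y i).
Qed.

Lemma card_antipodal_face (s : {set hypercube n}) :
  compat antipode s s -> 2 * #|s| <= 2 ^ n.
Proof.
move=> /compatP cs.
have : #|s :|: antipode @: s| <= 2 ^ n.
  by rewrite (leq_trans (max_card _)) // card_ffun card_bool card_ord.
rewrite cardsU card_imset; last exact: inv_inj antipodeK.
rewrite (_ : _ :&: _ = set0) ?cards0 ?subn0 ?mul2n ?addnn //.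
apply/setP => x; rewrite !inE; apply/andP => -[xs /imsetP[y ys xy]].
by have := cs y ys; rewrite -xy xs.
Qed.

(** Sending [y] to the set of coordinates where it differs from [x] is a bijection onto the subsets
    of ['I_n] that turns distance into cardinality. *)
Lemma card_hamming x (lo hi : nat) :
  #|[set y | lo <= hamming x y < hi]| = \sum_(lo <= i < hi) 'C(n, i).
Proof.
pose phi y : {set 'I_n} := [set i | x i != y i].
pose psi (A : {set 'I_n}) : hypercube n := [ffun i => (i \in A) (+) x i].
have phiK : cancel phi psi.
  by move=> y; apply/ffunP => i; rewrite ffunE inE; case: (x i); case: (y i).
have psiK : cancel psi phi.
  by move=> A; apply/setP => i; rewrite inE ffunE; case: (x i); case: (i \in A).
transitivity #|[set A : {set 'I_n} | lo <= #|A| < hi]|.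
  rewrite -(card_imset _ (can_inj phiK)); apply: eq_card => A.
  apply/imsetP/idP => [[y]|]; first by rewrite !inE => ? ->.
  rewrite -{1}(psiK A) inE => hA; exists (psi A); last by rewrite psiK.
  by rewrite inE.
rewrite -sum1_card big_mkcond /=.
under [RHS]eq_bigr => i _.
  rewrite -{1}(card_ord n) -card_draws -sum1_card big_mkcond /=.
  over.
rewrite exchange_big /=; apply: eq_bigr => A _; rewrite inE.
under [RHS]eq_bigr => i _ do rewrite inE eq_sym.
rewrite -big_mkcond sum1_count /= (eq_count (a2 := pred1 #|A|)) //.
by rewrite count_uniq_mem ?iota_uniq // mem_index_iota; case: ifP.
Qed.

Variable r : nat.

Definition far x y := r < hamming x y < n.

Definition far_edges : {set {set hypercube n}} :=
  [set [set p.1; p.2] | p in [set p : hypercube n * hypercube n | far p.1 p.2]].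

Lemma far_edgesP (f : {set hypercube n}) :
  reflect (exists x y, far x y /\ f = [set x; y]) (f \in far_edges).
Proof.
apply: (iffP imsetP) => [[[x y]]|[x [y [xy ->]]]].
  by rewrite inE /= => xy ->; exists x, y.
by exists (x, y); rewrite ?inE.
Qed.

Lemma far_sym x y : far x y = far y x.
Proof. by rewrite /far hamming_sym. Qed.

Lemma far_neq x y : far x y -> x != y.
Proof. by apply: contraTneq => ->; rewrite /far hammingxx. Qed.

Local Notation S := (\sum_(r.+1 <= i < n) 'C(n, i)).

Lemma card_far_edges_at x : #|[set f in far_edges | x \in f]| = S.
Proof.
rewrite -(card_hamming x).
have -> : [set f in far_edges | x \in f] =
    [set [set x; y] | y in [set y | far x y]].
  apply/setP => f; rewrite inE; apply/andP/imsetP => [[]|[y]].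
    case/far_edgesP => y [z [yz ->]]; rewrite !inE => /orP[] /eqP->.
      by exists z; rewrite ?inE.
    by exists y; rewrite ?inE 1?far_sym // setUC.
  rewrite inE => xy ->; rewrite !inE eqxx; split=> //.
  by apply/far_edgesP; exists x, y.
rewrite card_in_imset // => y z; rewrite !inE => /far_neq xy _ yz.
have : y \in [set x; z] by rewrite -yz !inE eqxx orbT.
by rewrite !inE eq_sym (negbTE xy) => /eqP.
Qed.

(** Double counting of incidences between vertices and far edges. *)
Lemma card_far_edges : 2 * #|far_edges| = 2 ^ n * S.
Proof.
have -> : 2 ^ n * S = \sum_(x : hypercube n) \sum_(f in far_edges) (x \in f).
  have <- : #|hypercube n| = 2 ^ n by rewrite card_ffun card_bool card_ord.
  rewrite -sum_nat_const; apply: eq_bigr => x _.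
  rewrite -(card_far_edges_at x) -sum1_card.
  rewrite [LHS]big_mkcond [RHS]big_mkcond; apply: eq_bigr => f _.
  by rewrite inE; case: (f \in far_edges) => //=; case: (x \in f).
rewrite exchange_big /= mulnC -sum_nat_const; apply: eq_bigr => f.
case/far_edgesP => x [y [/far_neq xy ->]].
by rewrite -big_mkcond /= sum1_card cards2 xy.
Qed.

Lemma compat_far_edge (f : {set hypercube n}) :
  f \in far_edges -> compat antipode f f.
Proof.
case/far_edgesP => x [y [xy ->]].
have n0 : 0 < n by apply: leq_ltn_trans (leq0n _) (proj2 (andP xy)).
have anti_neq z : antipode z != z.
  by rewrite eq_sym -hamming_eqn hammingxx eq_sym -lt0n.
have xyn u v : far u v -> antipode u != v.
  by rewrite eq_sym -hamming_eqn => /andP[_]; rewrite ltn_neqAle => /andP[].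
apply/compatP => z; rewrite !inE => /orP[] /eqP ->; rewrite negb_or anti_neq.
  exact: xyn.
by rewrite andbT xyn // far_sym.
Qed.

(** A conflicting edge passes through the antipode of [x] or of [y], with [S] far edges at each. The
    edge joining both antipodes is far as well and is counted twice, which saves one. *)
Lemma card_far_conflicts (f : {set hypercube n}) : f \in far_edges ->
  #|conflicts antipode far_edges f| <= 2 * S - 1.
Proof.
case/far_edgesP => x [y [xy ->]].
pose at_ z := [set f in far_edges | antipode z \in f].
have sub : conflicts antipode far_edges [set x; y] \subset at_ x :|: at_ y.
  apply/subsetP => g; rewrite !inE => /andP[->] /=.
  rewrite negb_forall => /existsP[z]; rewrite negb_imply negbK !inE.
  by case/andP => /orP[] /eqP-> ->; rewrite ?orbT.
apply: leq_trans (subset_leq_card sub) _.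
rewrite cardsU !card_far_edges_at mul2n -addnn leq_sub2l // card_gt0.
apply/set0Pn; exists [set antipode x; antipode y].
rewrite !inE !eqxx ?orbT /= andbT andbb.
by apply/far_edgesP; exists (antipode x), (antipode y); rewrite /far hamming_antipode.
Qed.

Lemma vietoris_rips_faces (rn : r < n) (s : {set hypercube n}) : s != set0 ->
  (s \in faces antipode set0 far_edges) =
  (s \in simplices (vietoris_rips (@hamming n) r)).
Proof.
move=> s0; rewrite [RHS]inE s0 /=.
apply/facesP/bigmax_leqP => [[/compatP ss _ sE] x xs|dr].
  apply/bigmax_leqP => y ys; rewrite leqNgt; apply/negP => rxy.
  have := hamming_le x y; rewrite leq_eqVlt hamming_eqn => /orP[/eqP yx|xyn].
    by have := ss x xs; rewrite -yx ys.
  have /sE/negP[] : [set x; y] \in far_edges.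
    by apply/far_edgesP; exists x, y; rewrite /far rxy.
  by rewrite subUset !sub1set xs.
have {}dr x y : x \in s -> y \in s -> hamming x y <= r.
  by move=> xs ys; have /bigmax_leqP := dr x xs; apply.
split; last 1 first.
- move=> _ /far_edgesP[x [y [/andP[rxy _] ->]]]; rewrite subUset !sub1set.
  by apply/negP => /andP[xs ys]; move: rxy; rewrite ltnNge dr.
- apply/compatP => x xs; apply/negP => /(dr x _ xs).
  have /eqP-> : hamming x (antipode x) == n by rewrite hamming_eqn.
  by rewrite leqNgt rn.
- exact: sub0set.
Qed.

End Hypercube.

(* The bound is never attained in integers: [2S - 1] is odd, prime to [S] and
   larger than 1, so it does not divide [2 ^ p * S]. *)
Lemma threshold_strict (p S j : nat) : 1 < S ->
  2 * 2 ^ p * (2 * S - 1) <= 2 ^ p * S + (2 * S - 1) * j ->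
  2 * 2 ^ p * (2 * S - 1) < 2 ^ p * S + (2 * S - 1) * j.
Proof.
move=> S1; rewrite leq_eqVlt => /orP[/eqP eq|//].
have dvd : (2 * S - 1) %| 2 ^ p * S.
  have : (2 * S - 1) %| 2 ^ p * S + (2 * S - 1) * j by rewrite -eq dvdn_mull.
  by rewrite dvdn_addl // dvdn_mulr.
have cS : coprime (2 * S - 1) S.
  rewrite /coprime -dvdn1 -[X in _ %| X](_ : 2 * S - (2 * S - 1) = 1); last by lia.
  by rewrite dvdn_sub ?dvdn_gcdl // dvdn_mull // dvdn_gcdr.
have c2 : coprime (2 * S - 1) (2 ^ p).
  by rewrite coprimeXr // coprimen2 oddB ?mul2n ?odd_double //; lia.
by move: dvd; rewrite Gauss_dvdl // => /gcdn_idPl; rewrite (eqP c2); lia.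
Qed.

(** * Vanishing of cohomology above the rational threshold *)

Local Open Scope ring_scope.

Theorem mainTheorem2 (n r : nat) (hn : (r + 1 < n)%N) (j : nat) :
  let S : rat := \sum_(r + 1 <= i < n) ('C(n, i))%:R in
  2 ^+ (n - 1) - 2 ^+ (n - 2) * S / (2 * S - 1) - 1 <= j%:R :> rat ->
  forall c : cohomology (vietoris_rips (@hamming n) r) j, c = 0.
Proof.
rewrite /= -natr_sum addn1; set S := (\sum_(_ <= i < n) _)%N.
case: n => [|[|p]] in hn S *; [by rewrite ltn0 in hn|by rewrite addn1 in hn|].
rewrite subn1 subn2 /= => bound.
(* The summand at [i = n - 1] alone equals [n], which is at least 2. *)
have S1 : (1 < S)%N.
  have rp : (r.+1 <= p.+1)%N by lia.
  by rewrite /S (big_nat_recr _ _ _ rp) /= binSn; lia.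
have SE : (2 * S - 1)%N%:R = 2 * S%:R - 1 :> rat.
  by rewrite natrB ?natrM //; lia.
have D0 : (0 < 2 * S%:R - 1 :> rat) by rewrite -SE ltr0n; lia.
(* Clear the denominator [2 * S - 1]; the final [- 1] of the threshold turns degree [j] into [j.+1]
   vertices. *)
have boundN : (2 * 2 ^ p * (2 * S - 1) <= 2 ^ p * S + (2 * S - 1) * j.+1)%N.
  rewrite -(ler_nat rat) natrD !natrM SE natrX -natr1.
  move: bound; rewrite -(ler_pM2r D0) exprS !mulrBl divfK ?gt_eqF //; lra.
have {bound boundN} bound := threshold_strict S1 boundN.
have q0 : (0 < 2 ^ p)%N by rewrite expn_gt0.
(* The threshold is positive, so degree 0 never occurs. *)
have j0 : (0 < j)%N by case: j bound => // bound; nia.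
have rn : (r < p.+2)%N by lia.
apply: (acyclic_cohomology (vietoris_rips_faces rn)) => //.
have cE := card_far_edges p.+2 r; rewrite -/S in cE.
apply: (acyclic_faces (@antipodeK _) (m := 2 ^ p.+1) (D := 2 * S - 1)).
- by move=> s /card_antipodal_face; rewrite (expnS _ p.+1) leq_pmul2l.
- by rewrite -card_gt0; nia.
- by move=> f /compat_far_edge.
- exact: card_far_conflicts.
- by move: cE bound; rewrite !expnS; nia.
Qed.
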